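(* Fix $0<c<1$. Let $d=d(n)$ with $d=o(n)$ (and $dn$ even). Then, as $n\to\infty$, \[ -O\left(\frac{1}{\log \frac{n}{d}}\right) \leq \frac{\log \lvert\mathcal{G}_{d,c}(n)\rvert}{\frac{dn}{2} \log \frac{n}{d+1}} - \left(1 - c\cdot \frac{d-1}{d+1}\right) \leq c\,\frac{\log d}{\log \frac{n}{d+1}} + O\left(\frac{1}{\log \frac{n}{d}}\right).\]
   Context: For $n,d$ let $T_{\max}=T_{\max}(n,d)=\binom{d}{2}\frac{n}{3}$ (the maximum number of triangles of an $n$-vertex $d$-regular graph). $\mathcal{G}_{d,c}(n)$ denotes the set of (simple) $d$-regular graphs on the $n$ labeled nodes $\{1,\dots,n\}$ that contain at least $c\cdot T_{\max}$ triangles. Throughout, $d=o(n)$. *)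

(* Defs.v *)
From mathcomp Require Import all_boot.
From Stdlib Require Import Reals.

Set Implicit Arguments.
Unset Strict Implicit.
Unset Printing Implicit Defensive.

Definition is_simple_graph (n : nat) (E : {set {set 'I_n}}) : bool :=
  [forall e in E, #|e| == 2].

Definition degree (n : nat) (E : {set {set 'I_n}}) (v : 'I_n) : nat :=
  #|[set e in E | v \in e]|.

Definition is_regular (n d : nat) (E : {set {set 'I_n}}) : bool :=
  [forall v : 'I_n, degree E v == d].

Definition triangles (n : nat) (E : {set {set 'I_n}}) : nat :=
  #|[set T : {set 'I_n} | (#|T| == 3) &&
      [forall x in T, forall y in T, (x != y) ==> ([set x; y] \in E)]]|.

Definition Tmax (n d : nat) : R := (INR 'C(d, 2) * (INR n / 3))%R.

Definition Gdc (n d : nat) (c : R) : {set {set {set 'I_n}}} :=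
  [set E : {set {set 'I_n}} | is_simple_graph E && is_regular d E &&
     (if Rle_dec (c * Tmax n d) (INR (triangles E)) then true else false)].

Definition Gdc_card (n d : nat) (c : R) : nat := #|Gdc n d c|.

(* Main.v *)
Require Import Defs.
From Stdlib Require Import Reals Lra.
From mathcomp Require Import all_boot fingroup perm order ssralg zmodp ssrnum.
From mathcomp Require Import Rstruct.
From mathcomp Require Import zify.

(* Write [M = d n / 2] and [X = n / (d+1)]; all errors below are O(M).

   Lower bound: take [k], about [c X], disjoint cliques K_(d+1), a random lift
   of K_(d+1) with fibre of size [t], about [(1-c) X], and one fixed d-regular
   graph on the at most [2 d + 1] remaining vertices. With the fibres fixed, the
   cliques are given by [d] permutations of [k] points and the lift by
   [(d+1) d / 2] permutations of [t] points, whence [(k!)^d (t!)^(d (d+1) / 2)]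
   graphs.

   Upper bound: fix an order of the vertices and call an edge cheap if it forms
   a triangle with a vertex preceding both its ends. An edge [e] in [T_e]
   triangles is cheap for a proportion [T_e / (T_e + 2) >= T_e / (d+1)] of the
   orders, so in a graph counted here at least [mu = c M (d-1) / (d+1)] edges
   are cheap on average. By Jensen it suffices to bound, for each order, the sum
   of [z ^ #cheap] over all d-regular graphs. Revealing the edges in order,
   each one present with odds [z d / n] if it would be
   cheap and [d / n] otherwise, shows that this sum is at most
   [(n / d)^M e^(2 M)], provided [z <= 1] or [z d^2 <= n]. Take
   [z = max 1 (n / d^2)]. *)

Set Implicit Arguments.
Unset Strict Implicit.
Unset Printing Implicit Defensive.

Delimit Scope nat_scope with N.
Delimit Scope ring_scope with R.
Delimit Scope R_scope with coqR.

(** * Cheap edges *)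

Section Graphs.
Variable n : nat.
Implicit Types (E : {set {set 'I_n}}) (e : {set 'I_n}) (v : 'I_n) (s : {perm 'I_n}).

Definition neighbours E v : {set 'I_n} := [set x | [set v; x] \in E].

Definition apexes E e : {set 'I_n} := [set v | [forall x in e, [set v; x] \in E]].

Definition below s e : {set 'I_n} := [set v | [forall x in e, s v < s x]].

(** The pair [e] need not belong to [E]: when pairs are revealed one at a time, the odds of a pair
    are fixed before its presence is known. *)
Definition cheap s E e : bool := below s e :&: apexes E e != set0.

Lemma simple_card2 E e : is_simple_graph E -> e \in E -> #|e| = 2.
Proof. by move=> /forall_inP h /h /eqP. Qed.

Lemma simple_loopless E v : is_simple_graph E -> [set v; v] \notin E.
Proof. by move=> sE; apply/negP => /(simple_card2 sE); rewrite setUid cards1. Qed.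

Lemma degree_neighbours E v : is_simple_graph E -> degree E v = #|neighbours E v|.
Proof.
move=> sE; rewrite /degree -(@card_in_imset _ _ (fun x => [set v; x]) (neighbours E v)).
  apply: eq_card => e; rewrite inE; apply/andP/imsetP => [[eE ve]|[x]].
    have /cards2P[a [b [ab eab]]] := introT eqP (simple_card2 sE eE).
    move: ve; rewrite eab !inE => /orP[] /eqP vE.
      by exists b; rewrite ?inE vE -?eab.
    by exists a; rewrite ?inE vE setUC -?eab.
  by rewrite inE => xE ->; rewrite xE !inE eqxx.
move=> x y; rewrite !inE => xE yE /setP /(_ x); rewrite !inE eqxx orbT.
case: eqP => [xv _|_ /esym/eqP //].
by move: (simple_loopless v sE); rewrite -{2}xv xE.
Qed.

Lemma handshake E d : is_simple_graph E -> is_regular d E -> #|E| * 2 = n * d.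
Proof.
move=> sE /forallP rE; transitivity (\sum_(v : 'I_n) degree E v); last first.
  by rewrite (eq_bigr (fun=> d)) ?sum_nat_const ?card_ord // => v _; apply/eqP.
rewrite -sum_nat_const (eq_bigr (fun e => #|e|)); last first.
  by move=> e eE; rewrite (simple_card2 sE).
rewrite (eq_bigr (fun e => \sum_(v | v \in e) 1)); last by move=> e _; rewrite sum1_card.
rewrite (exchange_big_dep predT) //=; apply: eq_bigr => v _.
by rewrite sum1_card; apply: eq_card => e; rewrite !inE.
Qed.

(** All apexes are neighbours of an end [a] of [e], and the other end [b] is a neighbour of [a] that
    is no apex, there being no loops. The strict inequality is what bounds [T_e + 2] by [d + 1]. *)
Lemma apexes_card E d e : is_simple_graph E -> is_regular d E -> e \in E ->
  #|apexes E e| < d.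
Proof.
move=> sE /forallP rE eE.
have /cards2P[a [b [ab eab]]] := introT eqP (simple_card2 sE eE).
rewrite -(eqP (rE a)) degree_neighbours //; apply: proper_card.
apply/properP; split.
  apply/subsetP => v; rewrite !inE => /forall_inP /(_ a).
  by rewrite setUC; apply; rewrite eab !inE eqxx.
exists b; first by rewrite inE -eab.
rewrite inE; apply/negP => /forall_inP /(_ b); rewrite eab !inE eqxx orbT => /(_ isT).
by apply/negP/simple_loopless.
Qed.

Lemma apexes_disjoint E e : is_simple_graph E -> [disjoint apexes E e & e].
Proof.
move=> sE; rewrite -setI_eq0; apply/eqP/setP => v; rewrite !inE.
apply/andP => -[/forall_inP h ve]; have := h v ve.
by apply/negP/simple_loopless.
Qed.

(** Deleting a vertex [v] from a triangle leaves an edge with apex [v]; edge and apex together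
    determine the triangle, which has three vertices to delete. *)
Lemma triangles_apexes E : triangles E * 3 <= \sum_(e in E) #|apexes E e|.
Proof.
rewrite /triangles; set Tri := [set _ | _].
rewrite -sum_nat_const (eq_bigr (fun T : {set 'I_n} => #|T|)); last first.
  by move=> T; rewrite inE => /andP[/eqP-> _].
under eq_bigr do rewrite -sum1_card.
under [leqRHS]eq_bigr do rewrite -sum1_card.
rewrite !pair_big_dep /= !sum1_card.
pose f (p : {set 'I_n} * 'I_n) := (p.1 :\ p.2, p.2).
rewrite -(@card_in_image _ _ f).
  apply: subset_leq_card; apply/subsetP => _ /imageP[[T v] /= /andP[TT vT] ->].
  rewrite [_ \in _]unfold_in /=; move: TT; rewrite inE => /andP[/eqP T3 /forall_inP TE].
  have /cards2P[a [b [ab eab]]] : #|T :\ v| == 2 by move: T3; rewrite (cardsD1 v) vT add1n => -[->].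
  have [aT bT] : a \in T :\ v /\ b \in T :\ v by rewrite eab !inE !eqxx orbT.
  move: (aT) (bT); rewrite !inE => /andP[av aT'] /andP[bv bT'].
  apply/andP; split; first by rewrite eab; move/forall_inP: (TE a aT') => /(_ b bT') /implyP; apply.
  apply/forall_inP => x; rewrite !inE => /andP[xv xT].
  by move/forall_inP: (TE v vT) => /(_ x xT) /implyP; apply; rewrite eq_sym.
move=> [T v] [T' v'] /andP[/= _ vT] /andP[/= _ vT'] [] eT ev; subst v'.
by rewrite -(setD1K vT) eT setD1K.
Qed.

(** * Uniformly random vertex orders *)

Definition first s (S : {set 'I_n}) v : bool := [forall y in S, s v <= s y].

Lemma card_first_le s (S : {set 'I_n}) :
  #|[set v in S | first s S v]| <= 1.
Proof.
apply/card_le1_eqP => x y; rewrite !inE => /andP[xS /forall_inP xm] /andP[yS /forall_inP ym].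
by apply: (@perm_inj _ s); apply/val_inj/anti_leq; rewrite xm ?ym.
Qed.

Lemma first_exists s (S : {set 'I_n}) : S != set0 -> exists2 v, v \in S & first s S v.
Proof.
case/set0Pn => x xS; case: (arg_minnP (fun v => s v : nat) xS) => v vS vm.
by exists v => //; apply/forall_inP.
Qed.

(** Precomposing an order with the transposition of [x] and [y] preserves [S] and exchanges the
    orders in which [x] comes first with those in which [y] does. *)
Lemma card_first_sym (S : {set 'I_n}) x y : x \in S -> y \in S ->
  #|[set s | first s S x]| = #|[set s | first s S y]|.
Proof.
move=> xS yS; pose t := tperm x y.
have tS z : (t z \in S) = (z \in S) by rewrite /t; case: tpermP => [->|->|//]; rewrite ?xS ?yS.
have inj_t : injective (fun s : {perm 'I_n} => (t * s)%g) by apply: mulgI.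
rewrite -(card_imset _ inj_t); apply: eq_card => s; rewrite !inE.
apply/imsetP/idP => [[s']|h].
  rewrite inE => /forall_inP h -> ; apply/forall_inP => z zS.
  by rewrite !permM /t tpermR h // tS.
exists (t * s)%g; last by rewrite mulgA tperm2 mul1g.
by rewrite inE; apply/forall_inP => z zS; rewrite !permM /t tpermL (forall_inP h) // tS.
Qed.

Lemma card_first (S : {set 'I_n}) x : x \in S ->
  n`! <= #|S| * #|[set s | first s S x]|.
Proof.
move=> xS; rewrite -sum_nat_const.
rewrite (eq_bigr (fun y => \sum_(s | first s S y) 1)); last first.
  by move=> y yS; rewrite (card_first_sym xS yS) sum1_card cardsE.
have -> : n`! = \sum_(s : {perm 'I_n}) 1.
  by rewrite sum1_card -card_Sn; apply: eq_card => s; rewrite !inE.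
rewrite (exchange_big_dep predT) //=; apply: leq_sum => s _; have [|y yS fy] := @first_exists s S; first by apply/set0Pn; exists x.
by rewrite (bigD1 y) //= yS.
Qed.

(* A uniformly random [s] puts first a uniformly random vertex of [apexes E e :|: e]. *)
Lemma card_cheap E e : is_simple_graph E ->
  n`! * #|apexes E e| <= #|[set s | cheap s E e]| * (#|apexes E e| + #|e|).
Proof.
move=> sE; set A := apexes E e; set S := A :|: e.
have cS : #|S| = #|A| + #|e|.
  by rewrite cardsU (disjoint_setI0 (apexes_disjoint _ sE)) cards0 subn0.
rewrite -cS; have [->|/set0Pn[x xA]] := eqVneq A set0; first by rewrite cards0 muln0.
have xS : x \in S by rewrite inE xA.
apply: (leq_trans (leq_mul (card_first xS) (leqnn _))).
rewrite -mulnA mulnC leq_mul2r; apply/orP; right; rewrite mulnC -sum_nat_const.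
rewrite (eq_bigr (fun y => \sum_(s | first s S y) 1)); last first.
  by move=> y yA; rewrite sum1_card -(@card_first_sym S y x) ?cardsE // inE yA.
rewrite (exchange_big_dep predT) //= -sum1_card [leqRHS]big_mkcond /=.
apply: leq_sum => s _; rewrite sum1_card inE.
case: ifPn => [_|/negP ns]; last first.
  rewrite leqn0; apply/eqP/eq_card0 => y; rewrite !inE; apply/negP => /andP[yA /forall_inP fy].
  apply: ns; apply/set0Pn; exists y; rewrite in_setI yA andbT inE.
  apply/forall_inP => z ze; rewrite ltn_neqAle fy ?inE ?ze ?orbT // andbT.
  apply/negP => /eqP/val_inj/perm_inj yz; have := apexes_disjoint e sE.
  by rewrite -setI_eq0 => /eqP/setP/(_ y); rewrite in_setI yA yz ze in_set0.
apply: leq_trans (card_first_le s S); apply: subset_leq_card; apply/subsetP => y.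
by rewrite unfold_in /= => /andP[yA fy]; rewrite inE fy in_setU yA.
Qed.

Definition ncheap s E := #|[set e in E | cheap s E e]|.

(** Count the pairs of an order and a cheap edge edge by edge, replacing the denominator [T_e + 2]
    from [card_cheap] by its bound [d + 1]; then sum [T_e] with [triangles_apexes]. *)
Lemma sum_ncheap E d : is_simple_graph E -> is_regular d E ->
  n`! * (triangles E * 3) <= (\sum_s ncheap s E) * d.+1.
Proof.
move=> sE rE; apply: (leq_trans (leq_mul (leqnn _) (triangles_apexes E))).
rewrite (eq_bigr (fun s => \sum_(e in E | cheap s E e) 1)); last first.
  by move=> s _; rewrite sum1_card; apply: eq_card => e; rewrite !inE.
rewrite (exchange_big_dep (mem E)) /=; last by move=> s e _ /andP[].
rewrite big_distrr big_distrl /=; apply: leq_sum => e eE.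
apply: (leq_trans (card_cheap e sE)).
rewrite (simple_card2 sE eE) addn2 leq_mul ?ltnS ?(apexes_card sE rE eE) //.
rewrite sum1_card; apply: subset_leq_card; apply/subsetP => s.
by rewrite !inE /= [s \in _]unfold_in /= eE.
Qed.

(** The cheapness of [e] is decided by the pairs joining an end of [e] to a vertex [v] below [e].
    Everything below such a pair is below [e], while [v] itself is not below the pair. So
    [#|below s e|] can serve as the time at which [e] is revealed. *)
Lemma cheap_adapted s E E' e :
  (forall e', #|below s e'| < #|below s e| -> (e' \in E) = (e' \in E')) ->
  cheap s E e = cheap s E' e.
Proof.
move=> EE'; rewrite /cheap; congr (_ != _); apply/setP => v; rewrite !in_setI.
case vb: (v \in below s e) => //=; rewrite !inE; apply: eq_forallb_in => x xe.
apply: EE'; apply: proper_card; apply/properP; move: vb; rewrite inE => /forall_inP vb.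
split.
  apply/subsetP => u; rewrite !inE => /forall_inP h; apply/forall_inP => y ye.
  by apply: ltn_trans (vb y ye); apply: h; rewrite !inE eqxx.
exists v; first by rewrite inE; apply/forall_inP.
by rewrite inE; apply/negP => /forall_inP /(_ v); rewrite !inE eqxx ltnn => /(_ isT).
Qed.

Definition pairs : {set {set 'I_n}} := [set e : {set 'I_n} | #|e| == 2].

Lemma simple_sub_pairs E : is_simple_graph E -> E \subset pairs.
Proof. by move=> /forall_inP h; apply/subsetP => e /h; rewrite inE. Qed.

Lemma card_pairs : #|pairs| = 'C(n, 2).
Proof. by rewrite card_draws card_ord. Qed.

(** A pair, present or not, is cheap only if it lies inside the neighbourhood of some vertex, and
    each of the [n] neighbourhoods contains ['C(d, 2)] pairs. *)
Lemma cheap_pairs_le s E d : is_simple_graph E -> is_regular d E ->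
  #|[set e in pairs | cheap s E e]| <= n * 'C(d, 2).
Proof.
move=> sE /forallP rE.
pose D v := [set e : {set 'I_n} | e \subset neighbours E v & #|e| == 2].
have -> : n * 'C(d, 2) = \sum_(v : 'I_n) #|D v|.
  rewrite (eq_bigr (fun=> 'C(d, 2))) ?sum_nat_const ?card_ord // => v _.
  by rewrite cards_draws -degree_neighbours // (eqP (rE v)).
apply: (@leq_trans #|\bigcup_v D v|).
  apply: subset_leq_card; apply/subsetP => e; rewrite !inE => /andP[e2 /set0Pn[v]].
  rewrite !inE => /andP[_ /forall_inP ve]; apply/bigcupP; exists v => //.
  by rewrite inE e2 andbT; apply/subsetP => x /ve; rewrite inE.
elim/big_rec2: _ => [|v m A _ h]; first by rewrite cards0.
by apply: leq_trans (leq_card_setU _ _) _; rewrite leq_add2l.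
Qed.

End Graphs.

(** * Graphs with many triangles *)

Section Edges.
Variables (n : nat) (V : finType) (h : 'I_n -> V) (hB : bijective h).
Variable g : rel V.
Hypotheses (gS : symmetric g) (gI : irreflexive g).

(** The graphs are built on structured vertex types; [h] carries them to the labels. *)
Definition edges : {set {set 'I_n}} :=
  [set [set p.1; p.2] | p in [set p : 'I_n * 'I_n | g (h p.1) (h p.2)]].

Lemma edgesE x y : ([set x; y] \in edges) = g (h x) (h y).
Proof.
apply/imsetP/idP => [[[a b]]|gxy]; last by exists (x, y); rewrite ?inE.
rewrite inE /= => gab e.
have ab : a != b by apply/eqP => ab; rewrite ab gI in gab.
have := set21 a b; have := set22 a b; rewrite -e !inE.
by case/orP=> /eqP bE; case/orP=> /eqP aE; move: gab ab; rewrite aE bE ?eqxx // gS.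
Qed.

Lemma edges_simple : is_simple_graph edges.
Proof.
apply/forall_inP => e /imsetP[[a b]]; rewrite inE /= => gab ->.
by rewrite cards2; case: (a =P b) gab => // ->; rewrite gI.
Qed.

Lemma edges_regular d : (forall v, #|[set w | g v w]| = d) -> is_regular d edges.
Proof.
move=> gd; apply/forallP => x; rewrite degree_neighbours ?edges_simple //.
rewrite -(gd (h x)) -(on_card_preimset (f := h) (onW_bij _ hB)).
by apply/eqP/eq_card => y; rewrite !inE edgesE.
Qed.

Lemma edges_triangles (TT : {set {set V}}) :
  (forall T, T \in TT -> #|T| = 3 /\ {in T &, forall x y, x != y -> g x y}) ->
  #|TT| <= triangles edges.
Proof.
move=> hT; have [h' hK h'K] := hB.
rewrite -(card_imset (f := fun T : {set V} => h @^-1: T) TT); last first.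
  move=> T T' /setP e; apply/setP => v; have := e (h' v); by rewrite !inE h'K.
apply: subset_leq_card; apply/subsetP => _ /imsetP[T /hT[T3 Tg] ->].
rewrite inE on_card_preimset ?T3 //=; last exact: onW_bij.
apply/forall_inP => x; rewrite inE => xT; apply/forall_inP => y; rewrite inE => yT.
by apply/implyP => xy; rewrite edgesE; apply: Tg => //; rewrite (inj_eq (bij_inj hB)).
Qed.

End Edges.

Lemma edges_inj n (V : finType) (h : 'I_n -> V) (g g' : rel V) : bijective h ->
  symmetric g -> irreflexive g -> symmetric g' -> irreflexive g' ->
  edges h g = edges h g' -> g =2 g'.
Proof.
move=> [h' _ h'K] gS gI gS' gI' e u v.
by rewrite -(h'K u) -(h'K v) -!edgesE // e.
Qed.

(** * Disjoint unions and lifts of complete graphs *)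

Section SumRel.
Variables (A B : finType) (f : rel A) (g : rel B).

Definition sum_rel : rel (A + B) := fun u v =>
  match u, v with
  | inl x, inl y => f x y
  | inr x, inr y => g x y
  | _, _ => false
  end.

Lemma sum_rel_sym : symmetric f -> symmetric g -> symmetric sum_rel.
Proof. by move=> fS gS [x|x] [y|y] /=. Qed.

Lemma sum_rel_irr : irreflexive f -> irreflexive g -> irreflexive sum_rel.
Proof. by move=> fS gS [x|x] /=. Qed.

Lemma sum_rel_degree d : (forall x, #|[set y | f x y]| = d) ->
  (forall x, #|[set y | g x y]| = d) -> forall u, #|[set v | sum_rel u v]| = d.
Proof.
move=> fd gd [x|x].
  rewrite -(fd x) -(card_imset _ (@inl_inj A B)); apply: eq_card => -[y|y].
    by rewrite mem_imset ?inE //; apply: inl_inj.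
  by rewrite inE; apply/esym/imsetP => -[].
rewrite -(gd x) -(card_imset _ (@inr_inj A B)); apply: eq_card => -[y|y].
  by rewrite inE; apply/esym/imsetP => -[].
by rewrite mem_imset ?inE //; apply: inr_inj.
Qed.
End SumRel.

Section Lift.
Variables (I J : finType).
Implicit Type rho : I -> I -> {perm J}.

(* The lift of the complete graph on [I] with fibre [J] and voltages [rho]. *)
Definition lift_rel rho : rel (I * J) :=
  fun u v => (u.1 != v.1) && (rho u.1 v.1 u.2 == v.2).

Lemma lift_rel_sym rho : (forall i j, rho j i = (rho i j)^-1)%g -> symmetric (lift_rel rho).
Proof.
move=> rhoV [i a] [j b]; rewrite /lift_rel /= eq_sym; congr (_ && _).
by rewrite rhoV; apply/eqP/eqP => [<-|<-]; rewrite ?permK ?permKV.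
Qed.

Lemma lift_rel_irr rho : irreflexive (lift_rel rho).
Proof. by move=> u; rewrite /lift_rel eqxx. Qed.

Lemma lift_rel_degree rho u : #|[set v | lift_rel rho u v]| = #|I|.-1.
Proof.
case: u => i a; have inj : injective (fun j => (j, rho i j a)) by move=> j j' [].
rewrite -cardsT (cardsD1 i) inE add1n /= -(card_imset _ inj).
apply: eq_card => -[j b]; rewrite inE /lift_rel /=.
apply/andP/imsetP => [[ij /eqP <-]|[j']]; first by exists j; rewrite // !inE eq_sym ij.
by rewrite !inE => /andP[ij _] [-> ->]; rewrite eq_sym ij eqxx.
Qed.

(** The only neighbour of [(i, a)] in the fibre over [j] is [(j, rho i j a)]. *)
Lemma lift_rel_inj rho rho' : lift_rel rho =2 lift_rel rho' ->
  forall i j, i != j -> rho i j = rho' i j.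
Proof.
move=> e i j ij; apply/permP => a; have := e (i, a) (j, rho i j a).
by rewrite /lift_rel /= ij eqxx => /esym/eqP.
Qed.

End Lift.

(** * Existence of regular graphs *)

Lemma card_pairs_lt d : #|[pred p : 'I_d * 'I_d | p.1 < p.2]| = 'C(d, 2).
Proof.
rewrite -bin2_sum big_mkord -sum1_card.
rewrite -(pair_big_dep xpredT (fun i j : 'I_d => i < j) (fun _ _ => 1)) /=.
rewrite (exchange_big_dep xpredT) //=; apply: eq_bigr => j _.
by rewrite -(big_ord_widen d (fun=> 1)) ?sum1_card ?card_ord //; apply: ltnW.
Qed.

Lemma card_ord_mem N (s : seq nat) : uniq s -> all (fun x => x < N) s ->
  #|[set z : 'I_N | val z \in s]| = size s.
Proof.
move=> us hs; pose s' := pmap (insub : nat -> option 'I_N) s.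
have <- : size s' = size s.
  by rewrite size_pmap_sub; apply/eqP; rewrite -all_count.
have /card_uniqP <- : uniq s' by apply: pmap_sub_uniq.
by apply: eq_card => z; rewrite inE mem_pmap_sub.
Qed.

(** A circulant graph: [x] and [y] are joined when [y - x] lies in a symmetric set [D] of [d]
    nonzero residues, namely 1, ..., [d./2], their negatives and, for odd [d], the residue of order
    two, which exists because the modulus is then even. *)
Lemma regular_rel_exists N d : d < N -> ~~ odd (d * N) ->
  exists g : rel 'I_N, [/\ symmetric g, irreflexive g & forall x, #|[set y | g x y]| = d].
Proof.
case: N => // N dN dNe.
pose s := iota 1 d./2 ++ iota (N.+1 - d./2) d./2 ++ (if odd d then [:: N.+1./2] else [::]).
have memE z : (z \in s) = [|| (0 < z <= d./2), (N.+1 - d./2 <= z < N.+1) | odd d && (z == N.+1./2)].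
  rewrite !mem_cat !mem_iota subnK; last by lia.
  by congr [|| _, _ | _]; case: (odd d); rewrite ?inE ?in_nil //; lia.
have sN : all (fun x => x < N.+1) s by apply/allP => z; rewrite memE; lia.
have us : uniq s.
  rewrite !cat_uniq !iota_uniq /= -!all_predC.
  apply/and3P; split.
  - by apply/allP => z; rewrite /= mem_cat !mem_iota; move: dNe; rewrite oddM; case dO: (odd d); rewrite ?inE ?in_nil; lia.
  - by move: dNe; rewrite oddM; case dO: (odd d); rewrite //= mem_iota; lia.
  - by case: (odd d).
have ss : size s = d.
  by rewrite !size_cat !size_iota; have := odd_double_half d; case: (odd d) => /=; lia.
pose D := [set z : 'I_N.+1 | val z \in s].
have Dc : #|D| = d by rewrite card_ord_mem.
have D0 : 0%R \notin D by rewrite inE memE /=; lia.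
have DN z : (- z)%R \in D = (z \in D).
  suff h z' : z' \in D -> (- z')%R \in D by apply/idP/idP => /h; rewrite ?GRing.opprK.
  move=> zD; have z0 : (z' : nat) != 0 by apply: contraNneq D0 => z0; rewrite (_ : 0%R = z') //; apply: val_inj.
  move: zD z0 (ltn_ord z') dNe; rewrite !inE /= !memE oddM.
  by move: (nat_of_ord z') => w zD z0 zN dNe'; rewrite modn_small; lia.
exists (fun x y => (y - x)%R \in D); split.
- by move=> x y; rewrite -DN GRing.opprB.
- by move=> x; rewrite GRing.subrr (negbTE D0).
- move=> x; rewrite -[RHS]Dc -(card_imset (mem D) (@GRing.addIr _ x)).
  apply: eq_card => y; rewrite [LHS]in_set; apply/idP/imsetP => [yD|[z zD ->]].
    by exists (y - x)%R; rewrite // GRing.subrK.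
  by rewrite GRing.addrK.
Qed.

(** * Voltages for the cliques and for the random lift *)

Section Voltages.
Variables (d k : nat).

(** Position [ord0] is normalised to the identity; this is why [d] permutations, and not [d + 1],
    parametrise the cliques, and why [s] can be read off from the voltages. *)
Definition clique_frame (s : {ffun 'I_d -> 'S_k}) (i : 'I_d.+1) : 'S_k :=
  if unlift ord0 i is Some j then s j else 1%g.

(* A coboundary, so the lift splits into [k] disjoint copies of the complete graph. *)
Definition clique_voltage s i j : 'S_k := (clique_frame s i * (clique_frame s j)^-1)%g.

Lemma clique_voltageV s i j : clique_voltage s j i = (clique_voltage s i j)^-1%g.
Proof. by rewrite /clique_voltage invMg invgK. Qed.

Lemma clique_voltage_inj s s' :
  (forall i j, i != j -> clique_voltage s i j = clique_voltage s' i j) -> s = s'.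
Proof.
move=> e; apply/ffunP => i; have := e ord0 (lift ord0 i) (neq_lift _ _).
by rewrite /clique_voltage /clique_frame unlift_none liftK !mul1g => /invg_inj.
Qed.

(** The clique with index [a] meets the fibre over [i] in the point that the frame of [i] sends to
    [a]; this is its part over a given set of positions. *)
Definition clique_triple s (p : {set 'I_d.+1} * 'I_k) : {set 'I_d.+1 * 'I_k} :=
  [set (i, (clique_frame s i)^-1%g p.2) | i in p.1].

Lemma card_clique_triple s p : #|clique_triple s p| = #|p.1|.
Proof. by rewrite card_imset // => i j []. Qed.

Lemma clique_triple_adj s p : {in clique_triple s p &, forall u v,
  u != v -> lift_rel (clique_voltage s) u v}.
Proof.
case: p => A a _ _ /imsetP[i iA ->] /imsetP[j jA ->] /= uv; rewrite /lift_rel /=.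
have ij : i != j by apply: contra uv => /eqP->.
by rewrite ij /clique_voltage permM permKV eqxx.
Qed.

Lemma clique_triple_inj s : {in [pred p | p.1 != set0] &, injective (clique_triple s)}.
Proof.
move=> [A a] [B b] A0 _ e; rewrite inE /= in A0.
have sub (C D : {set 'I_d.+1}) x y : clique_triple s (C, x) \subset clique_triple s (D, y) ->
    forall i, i \in C -> i \in D /\ x = y.
  move=> /subsetP h i iC; have /h : (i, (clique_frame s i)^-1%g x) \in clique_triple s (C, x).
    by apply/imsetP; exists i.
  by case/imsetP => j jD /= [-> /perm_inj].
case/set0Pn: A0 => i iA; have [_ ab] : i \in B /\ a = b by apply: sub iA; rewrite e.
congr pair => //; apply/setP => x; apply/idP/idP => xX.
  by have [] : x \in B /\ a = b by apply: sub xX; rewrite e.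
by have [] : x \in A /\ b = a by apply: sub xX; rewrite e.
Qed.

Definition pair_voltage (p : {ffun 'I_d * 'I_d -> 'S_k}) (i j : 'I_d) : 'S_k :=
  if i < j then p (i, j) else if j < i then (p (j, i))^-1%g else 1%g.

Lemma pair_voltageV p i j : pair_voltage p j i = (pair_voltage p i j)^-1%g.
Proof. by rewrite /pair_voltage; case: ltngtP; rewrite ?invgK ?invg1. Qed.

Definition pair_voltages : pred {ffun 'I_d * 'I_d -> 'S_k} :=
  pffun_on 1%g [pred ij : 'I_d * 'I_d | ij.1 < ij.2] predT.

Lemma card_pair_voltages : #|pair_voltages| = k`! ^ 'C(d, 2).
Proof.
rewrite /pair_voltages card_pffun_on card_pairs_lt; congr (_ ^ _).
by rewrite -card_Sn; apply: eq_card => s; rewrite !inE.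
Qed.

Lemma pair_voltage_inj p p' : p \in pair_voltages -> p' \in pair_voltages ->
  (forall i j, i != j -> pair_voltage p i j = pair_voltage p' i j) -> p = p'.
Proof.
move=> /pffun_onP[/supportP hp _] /pffun_onP[/supportP hp' _] e; apply/ffunP => -[i j].
have [ij|ji] := boolP (i < j).
  by have := e i j; rewrite /pair_voltage ij; apply; rewrite neq_ltn ij.
by rewrite hp ?hp'.
Qed.
End Voltages.

(** The three blocks occupy fixed labels, so distinct parameters give distinct graphs. The triangles
    inside the cliques alone reach the required number. *)
Lemma Gdc_card_ge n d k t N (c : R) :
  n = d.+1 * k + d.+1 * t + N -> d < N -> ~~ odd (d * N) ->
  Rle (c * Tmax n d)%coqR (INR ('C(d.+1, 3) * k)) ->
  k`! ^ d * t`! ^ 'C(d.+1, 2) <= Gdc_card n d c.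
Proof.
move=> nE dN dNe hT; have [g [gS gI gd]] := regular_rel_exists dN dNe.
pose V : finType := (('I_d.+1 * 'I_k) + ('I_d.+1 * 'I_t) + 'I_N)%type.
have cV : n = #|V| by rewrite !card_sum !card_prod !card_ord nE.
pose h (x : 'I_n) : V := enum_val (cast_ord cV x).
have hB : bijective h.
  exists (fun v => cast_ord (esym cV) (enum_rank v)) => x; rewrite /h.
    by rewrite enum_valK cast_ordK.
  by rewrite cast_ordKV enum_rankK.
pose rel_of (q : {ffun 'I_d -> 'S_k} * {ffun 'I_d.+1 * 'I_d.+1 -> 'S_t}) : rel V :=
  sum_rel (sum_rel (lift_rel (clique_voltage q.1)) (lift_rel (pair_voltage q.2))) g.
have relS q : symmetric (rel_of q).
  apply: sum_rel_sym gS; apply: sum_rel_sym; apply: lift_rel_sym => i j.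
    exact: clique_voltageV.
  exact: pair_voltageV.
have relI q : irreflexive (rel_of q).
  by apply: sum_rel_irr gI; apply: sum_rel_irr; apply: lift_rel_irr.
have reld q v : #|[set w | rel_of q v w]| = d.
  by apply: sum_rel_degree v => //; apply: sum_rel_degree => u;
    rewrite lift_rel_degree card_ord.
pose Q := [pred q : {ffun 'I_d -> 'S_k} * {ffun 'I_d.+1 * 'I_d.+1 -> 'S_t} |
  (q.1 \in predT) && (q.2 \in @pair_voltages d.+1 t)].
have <- : #|Q| = k`! ^ d * t`! ^ 'C(d.+1, 2).
  rewrite (eq_card (_ : _ =i [predX predT & @pair_voltages d.+1 t])); last by [].
  rewrite cardX card_pair_voltages card_ffun card_ord; congr (_ ^ _ * _).
  by rewrite -card_Sn; apply: eq_card => s; rewrite !inE.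
rewrite -(@card_in_imset _ _ (fun q => edges h (rel_of q)) Q).
  apply: subset_leq_card; apply/subsetP => _ /imsetP[q _ ->]; rewrite inE.
  rewrite edges_simple ?(edges_regular hB) //=.
  case: Rle_dec => // -[]; apply: Rle_trans hT _; apply: le_INR; apply/leP.
  pose P := [pred p : {set 'I_d.+1} * 'I_k | #|p.1| == 3].
  have inl2 : injective (fun u => inl (inl u) : V) by move=> u v [].
  have P0 p : p \in P -> p \in [pred p | p.1 != set0].
    by rewrite !inE -card_gt0 => /eqP->.
  pose TT := [set (fun u => inl (inl u) : V) @: clique_triple q.1 p | p in P].
  have <- : #|TT| = 'C(d.+1, 3) * k.
    rewrite card_in_imset => [|p p' pP pP' /imset_inj e]; last first.
      by apply: (@clique_triple_inj _ _ q.1); [exact: P0 | exact: P0 | exact: e].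
    rewrite -[in LHS]/(#|[pred p | (p.1 \in [pred A : {set 'I_d.+1} | #|A| == 3]) && (p.2 \in predT)]|).
    rewrite (eq_card (_ : _ =i [predX [pred A : {set 'I_d.+1} | #|A| == 3] & predT])); last first.
      by move=> p; rewrite !inE andbT.
    rewrite cardX card_ord; congr (_ * _).
    by rewrite -[in RHS](card_ord d.+1) -card_draws cardsE.
  apply: edges_triangles => // _ /imsetP[p pP ->]; split.
    by rewrite card_imset // card_clique_triple; apply/eqP.
  move=> _ _ /imsetP[u up ->] /imsetP[v vp ->] uv /=.
  by apply: clique_triple_adj up vp _; apply: contra uv => /eqP->.
move=> [s p] [s' p'] /andP[_ /= hp] /andP[_ /= hp'] /edges_inj e.
have {}e := e hB (relS _) (relI _) (relS _) (relI _).
congr pair.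
  apply: clique_voltage_inj; apply: lift_rel_inj => u v.
  exact: (e (inl (inl u)) (inl (inl v))).
apply: pair_voltage_inj hp hp' _; apply: lift_rel_inj => u v.
exact: (e (inl (inr u)) (inl (inr v))).
Qed.

(** * Weighted count of regular graphs *)

Section RegularWeights.
Import Order.TTheory GRing.Theory Num.Theory.
Local Open Scope ring_scope.

Lemma big_powerset_setU1 (F : nmodType) (T : finType) (e : T) (S : {set T})
    (f : {set T} -> F) : e \notin S ->
  \sum_(E in powerset (e |: S)) f E
  = \sum_(E in powerset S) (f E + f (e |: E)).
Proof.
move=> eS; rewrite big_split /= (bigID (fun E : {set T} => e \notin E)) /=.
congr (_ + _).
  apply: eq_bigl => E; rewrite !inE; apply/andP/idP => [[ES eE]|ES].
    by rewrite -(setU1K eS); apply/subsetD1P.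
  by split; [apply: subset_trans ES (subsetU1 _ _) | apply: contra eS; apply: subsetP].
rewrite (reindex_onto (fun E => e |: E) (fun E => E :\ e)) /=; last first.
  by move=> E /andP[_]; rewrite negbK => /setD1K.
apply: eq_bigl => E; rewrite !inE eqxx /= andbT.
apply/andP/idP => [[ES /eqP <-]|ES]; first by rewrite -(setU1K eS) setSD.
split; first exact: setUS.
by rewrite setU1K //; apply: contra eS; apply: subsetP.
Qed.

(* The sum is the total probability of the random set that examines the
   elements in order of [r] and keeps [e] with probability [q E e]. *)
Lemma adaptive_total (F : comPzRingType) (T : finType) (r : T -> nat)
    (q : {set T} -> T -> F) (S : {set T}) :
  (forall (E E' : {set T}) e, (forall e', (r e' < r e)%N -> (e' \in E) = (e' \in E')) ->
     q E e = q E' e) ->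
  \sum_(E in powerset S) \prod_(e in S) (if e \in E then q E e else 1 - q E e) = 1.
Proof.
move=> qE; move: {2}#|S| (leqnn #|S|) => m; elim: m S => [|m IH] S.
  rewrite leqn0 cards_eq0 => /eqP->.
  by rewrite powerset0 big_set1 big_set0.
have [->|/set0Pn[e0 e0S]] := eqVneq S set0; first by rewrite powerset0 big_set1 big_set0.
(* Split off an element [e] revealed last: no other factor depends on whether [e] is present, and
   its own two factors add up to 1. *)
case: (arg_maxnP r e0S) => e eS emax Sm; have {}eS : e \in S := eS.
rewrite -(setD1K eS) big_powerset_setU1 ?setD11 // -[RHS](IH (S :\ e)); last first.
  by rewrite -ltnS; apply: leq_trans Sm; rewrite (cardsD1 e S) eS.
apply: eq_bigr => E; rewrite inE => ES.
have eE : e \notin E by apply/negP => /(subsetP ES); rewrite !inE eqxx.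
have qU e' : e' \in S -> q (e |: E) e' = q E e'.
  move=> e'S; apply: qE => u ru; rewrite !inE; case: eqP => // ue; subst u.
  by have := emax _ e'S; rewrite /= leqNgt ru.
rewrite !(big_setU1 e) ?setD11 //= setU11 (negbTE eE) qU //.
set a := \prod_(_ in _) _; set b := \prod_(_ in _) _.
have -> : b = a.
  apply: eq_bigr => e'; rewrite !inE => /andP[e'e e'S].
  by rewrite qU // (negbTE e'e).
by rewrite -mulrDl subrK mul1r.
Qed.

Lemma le_exp (x : R) : 1 + x <= exp x.
Proof. exact/RleP/exp_ineq1_le. Qed.

Lemma exp_sum (I : finType) (P : pred I) (f : I -> R) :
  \prod_(i | P i) exp (f i) = exp (\sum_(i | P i) f i)%R.
Proof.
by apply: (big_rec2 (fun x y : R => x = exp y)); rewrite ?exp_0 // => i x y _ ->; rewrite expRD.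
Qed.

Section Weight.
Variables (n : nat) (s : {perm 'I_n}).
Implicit Types (E : {set {set 'I_n}}) (e : {set 'I_n}).

Definition weight (z : R) E e : R := if cheap s E e then z else 1.


Lemma bin2_le m : ('C(m, 2)%:R : R) * 2 <= m%:R ^+ 2.
Proof.
rewrite -natrX -natrM ler_nat muln2 -mul2n mul_bin_left bin1 -mulnn mulnC leq_mul2l.
by rewrite leq_subr orbT.
Qed.

(** Pairs that are not cheap contribute at most [n^2 / 2], as there are ['C(n, 2)] pairs in all. The
    cheap ones contribute no more than that: if [z <= 1] for the same reason, otherwise because they
    number at most [n d^2 / 2] and [z d^2 <= n]. *)
Lemma sum_weight (d : nat) (z : R) E : is_simple_graph E -> is_regular d E -> 0 <= z ->
  z <= 1 \/ z * d%:R ^+ 2 <= n%:R ->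
  \sum_(e in pairs n) weight z E e <= n%:R ^+ 2.
Proof.
move=> sE rE z0 hz; pose K := [set e in pairs n | cheap s E e].
apply: (@le_trans _ _ ('C(n, 2)%:R + #|K|%:R * z)).
  rewrite -card_pairs -!sum1_card !natr_sum mulr_suml.
  rewrite [X in _ <= _ + X](eq_bigl (fun e => (e \in pairs n) && cheap s E e)); last first.
    by move=> e; rewrite !inE.
  rewrite [X in _ <= _ + X]big_mkcondr -big_split /=; apply: ler_sum => e _.
  by rewrite /weight; case: ifP => _; rewrite ?mul1r ?addr0 // lerDr ler01.
have n2 := bin2_le n; have d2 := bin2_le d.
suff hK : #|K|%:R * z * 2 <= n%:R ^+ 2.
  by rewrite -(@ler_pM2r _ 2) ?ltr0n // mulrDl [leRHS]mulr_natr mulr2n lerD.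
case: hz => hz.
  apply: le_trans n2; rewrite ler_pM2r ?ltr0n // -card_pairs.
  apply: (@le_trans _ _ #|K|%:R); first by rewrite ler_piMr ?ler0n.
  by rewrite ler_nat; apply: subset_leq_card; apply/subsetP => e; rewrite inE => /andP[].
have kd : (#|K|%:R : R) <= n%:R * 'C(d, 2)%:R.
  by rewrite -natrM ler_nat; apply: cheap_pairs_le.
apply: (@le_trans _ _ (n%:R * 'C(d, 2)%:R * z * 2)).
  by rewrite ler_pM2r ?ltr0n // ler_wpM2r.
rewrite expr2 -!mulrA ler_wpM2l ?ler0n //; apply: le_trans hz.
by rewrite mulrCA ler_wpM2l.
Qed.

(** Reveal the pairs with odds [p * weight z E e], where [p = d / n]. A graph then has probability
    equal to its term on the left times the product of [(1 + odds)^-1] over all pairs, and by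
    [sum_weight] that product is at least [exp (- d n)]. *)
Lemma sum_cheap_le (d : nat) (z : R) :
  (0 < n)%N -> 0 <= z -> z <= 1 \/ z * d%:R ^+ 2 <= n%:R ->
  \sum_(E | is_simple_graph E && is_regular d E)
     z ^+ ncheap s E * (d%:R / n%:R) ^+ #|E| <= exp (d%:R * n%:R)%R.
Proof.
move=> n0 z0 hz; set p := (d%:R : R) / n%:R.
have p0 : 0 <= p by rewrite divr_ge0 ?ler0n.
have w0 E e : 0 <= weight z E e by rewrite /weight; case: ifP.
have D0 E e : 0 < 1 + p * weight z E e by rewrite ltr_pwDl // mulr_ge0.
pose q E e := p * weight z E e / (1 + p * weight z E e).
have q1 E e : 1 - q E e = (1 + p * weight z E e)^-1.
  by rewrite /q -{1}(divff (lt0r_neq0 (D0 E e))) -mulrBl addrK mul1r.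
have q0 E e : 0 <= q E e by apply: divr_ge0; [exact: mulr_ge0 | exact: ltW].
have qa E E' e : (forall e', (#|below s e'| < #|below s e|)%N -> (e' \in E) = (e' \in E')) ->
    q E e = q E' e by rewrite /q /weight => /cheap_adapted ->.
have tot := @adaptive_total R _ (fun e => #|below s e|) q (pairs n) qa.
(* Multiply the right side by the total probability 1, then keep only the regular graphs. *)
rewrite -[leRHS]mulr1 -[X in _ <= _ * X]tot mulr_sumr.
rewrite [leRHS](bigID (fun E => is_simple_graph E && is_regular d E)) /=.
apply: ler_wpDr.
  apply: sumr_ge0 => E _; apply: mulr_ge0; first by apply: ltW; apply/RltP/exp_pos.
  by apply: prodr_ge0 => e _; case: ifP => _ //; rewrite q1 invr_ge0 ltW.
rewrite [leRHS](eq_bigl (fun E => is_simple_graph E && is_regular d E)); last first.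
  move=> E; rewrite powersetE; case sE: (is_simple_graph E); last by rewrite andbF.
  by rewrite simple_sub_pairs.
apply: ler_sum => E /andP[sE rE].
rewrite [X in _ <= _ * X](eq_bigr (fun e => (if e \in E then p * weight z E e else 1)
    * (1 + p * weight z E e)^-1)); last first.
  by move=> e _; case: ifP => _; rewrite ?mul1r.
rewrite big_split /= prodfV -big_mkcondr /=.
rewrite (eq_bigl (fun e => e \in E)); last first.
  by move=> e; case eE: (e \in E); rewrite ?andbF // (subsetP (simple_sub_pairs sE)).
rewrite big_split /= prodr_const mulrCA -mulrA [leLHS]mulrC ler_wpM2l ?exprn_ge0 //.
have -> : \prod_(e in E) weight z E e = z ^+ ncheap s E.
  rewrite /weight -big_mkcondr prodr_const; congr (_ ^+ _).
  by apply: eq_card => e; rewrite !inE.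
rewrite ler_peMr ?exprn_ge0 // ler_pdivlMr ?prodr_gt0 // mul1r.
apply: (@le_trans _ _ (\prod_(e in pairs n) exp (p * weight z E e)%R)).
  by apply: ler_prod => e _; rewrite ltW //= le_exp.
rewrite exp_sum -mulr_sumr; have := sum_weight sE rE z0 hz => hw.
have /RleP : p * \sum_(e in pairs n) weight z E e <= d%:R * n%:R.
  apply: le_trans (ler_wpM2l p0 hw) _; rewrite /p expr2 mulrA divfK //.
  by rewrite pnatr_eq0 -lt0n.
by move=> h; apply/RleP; case: (Rle_lt_or_eq_dec _ _ h) => [/exp_increasing /Rlt_le|->]; [|apply: Rle_refl].
Qed.

End Weight.

(** * Averaging over the vertex orders *)

Lemma jensen_exp (I : finType) (k : I -> R) (m : R) :
  #|I|%:R * m <= \sum_i k i -> #|I|%:R * exp m <= \sum_i exp (k i).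
Proof.
(* The tangent line to [exp] at [m] bounds each term from below. *)
move=> hm; apply: (@le_trans _ _ (\sum_i exp m * (1 + (k i - m)))).
  rewrite -mulr_sumr big_split /= sumrB !sumr_const mulrC.
  rewrite ler_wpM2l; first by []; first by apply/ltW/RltP/exp_pos.
  by rewrite lerDl subr_ge0 -mulr_natl.
apply: ler_sum => i _.
have -> : exp (k i) = exp m * exp (k i - m)%R by rewrite expRD RplusE subrKC.
by rewrite ler_wpM2l ?le_exp //; apply/ltW/RltP/exp_pos.
Qed.

(** Averaged over the orders, [ncheap s E] is at least [mu] by [sum_ncheap]; Jensen's inequality
    carries this over to the exponentials. *)
Lemma sum_exp_ncheap n d (E : {set {set 'I_n}}) (lam mu : R) : is_simple_graph E -> is_regular d E ->
  0 <= lam -> mu * d.+1%:R <= (triangles E * 3)%:R ->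
  n`!%:R * exp (lam * mu)%R <= \sum_s exp lam ^+ ncheap s E.
Proof.
move=> sE rE l0 hmu; have cP : #|{perm 'I_n}| = n`!.
  by rewrite -card_Sn; apply: eq_card => s; rewrite !inE.
rewrite -cP; under eq_bigr do rewrite expRX; apply: jensen_exp; rewrite cP.
under eq_bigr do rewrite -mulr_natr.
rewrite -mulr_sumr mulrCA ler_wpM2l // -(@ler_pM2r _ d.+1%:R) ?ltr0n //.
rewrite -mulrA; apply: le_trans (ler_wpM2l (ler0n _ _) hmu) _.
by rewrite -natr_sum -!natrM ler_nat; apply: sum_ncheap.
Qed.

(** Sum [sum_cheap_le] over all orders with [z = exp lam] and exchange the sums: each graph in [Gdc]
    has [M] edges and accounts for at least [n! exp (lam mu) (d / n)^M]. The factor [n!] cancels. *)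
Lemma Gdc_card_le n d M (c lam mu : R) : (0 < n)%N -> (M * 2 = n * d)%N ->
  0 <= lam -> exp lam <= 1 \/ exp lam * d%:R ^+ 2 <= n%:R ->
  mu * d.+1%:R <= c * Tmax n d * 3%:R ->
  (Gdc_card n d c)%:R * (exp (lam * mu)%R * (d%:R / n%:R) ^+ M) <= exp (d%:R * n%:R)%R.
Proof.
move=> n0 hM l0 hl hmu; set p := (d%:R : R) / n%:R.
have cP : #|{perm 'I_n}| = n`!.
  by rewrite -card_Sn; apply: eq_card => s; rewrite !inE.
have p0 : 0 <= p by rewrite divr_ge0 ?ler0n.
have e0 x : 0 <= exp x by apply/ltW/RltP/exp_pos.
rewrite -(@ler_pM2l _ n`!%:R) ?ltr0n ?fact_gt0 //.
have -> : n`!%:R * exp (d%:R * n%:R)%R = \sum_(s : {perm 'I_n}) exp (d%:R * n%:R)%R.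
  by rewrite sumr_const cP mulr_natl.
apply: le_trans (ler_sum _ (fun s _ => sum_cheap_le s n0 (e0 lam) hl)).
rewrite exchange_big /= mulrCA /Gdc_card -[#|Gdc n d c|]sum1_card natr_sum mulr_suml.
rewrite [leRHS](bigID (fun E => E \in Gdc n d c)) /=.
apply: ler_wpDr.
  by apply: sumr_ge0 => E _; apply: sumr_ge0 => s _; rewrite mulr_ge0 ?exprn_ge0 ?e0.
rewrite [leRHS](eq_bigl (fun E => E \in Gdc n d c)); last first.
  by move=> E; rewrite inE; case: (is_simple_graph E && _).
apply: ler_sum => E; rewrite inE => /andP[/andP[sE rE]]; case: Rle_dec => //= /RleP hT _.
have -> : M = #|E| by apply/eqP; rewrite -(eqn_pmul2r (isT : 0 < 2)%N) hM (handshake sE rE).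
rewrite mul1r -mulr_suml mulrA ler_wpM2r ?exprn_ge0 //.
apply: (@sum_exp_ncheap _ d) => //; apply: (le_trans hmu).
by rewrite natrM ler_wpM2r ?ler0n // -INRE.
Qed.

End RegularWeights.

(** * Asymptotics *)

Delimit Scope R_scope with R.
Local Open Scope R_scope.

(** * Binomials, logarithms and factorials *)

Lemma INR_bin2 d : INR 'C(d, 2) * 2 = INR d * (INR d - 1).
Proof.
case: d => [|d]; first by rewrite bin0n /=; lra.
have /(congr1 INR) : (d.+1 * d = 2 * 'C(d.+1, 2))%N by rewrite -mul_bin_diag bin1.
by rewrite !mult_INR [INR 2]S_INR !S_INR [INR 0]/=; lra.
Qed.

Lemma INR_bin3 d : INR 'C(d.+1, 3) * 3 = (INR d + 1) * INR 'C(d, 2).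
Proof.
have /(congr1 INR) : (d.+1 * 'C(d, 2) = 3 * 'C(d.+1, 3))%N by rewrite -mul_bin_diag.
by rewrite !mult_INR !S_INR [INR 0]/=; lra.
Qed.

Lemma INR_expn a b : INR (a ^ b)%N = INR a ^ b.
Proof. by elim: b => [|b IH]; rewrite ?expn0 //= expnS mult_INR IH. Qed.

Lemma ln_le_sub1 x : 0 < x -> ln x <= x - 1.
Proof. by move=> x0; have := exp_ineq1_le (ln x); rewrite exp_ln //; lra. Qed.

Lemma ln_mono x y : 0 < x -> x <= y -> ln x <= ln y.
Proof. by move=> x0 [xy|->]; [apply/Rlt_le/ln_increasing | apply: Rle_refl]. Qed.

Lemma ln_quot x y : 0 < x -> 0 < y -> ln (x / y) = ln x - ln y.
Proof.
by move=> x0 y0; rewrite /Rdiv ln_mult ?ln_Rinv //; apply: Rinv_0_lt_compat.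
Qed.

(** A weak form of Stirling's formula, by induction: the increment needs
    [k (ln (k + 1) - ln k) <= 1], which for positive [k] is [ln_le_sub1] at [(k + 1) / k]. *)
Lemma ln_fact_ge k : INR k * ln (INR k) - INR k <= ln (INR k`!).
Proof.
elim: k => [|k IH]; first by rewrite fact0 /= ln_1; lra.
have f0 : 0 < INR k`! by apply: lt_0_INR; apply/ltP/fact_gt0.
have k1 : 0 < INR k.+1 by apply: lt_0_INR; apply/ltP.
rewrite factS mult_INR ln_mult //.
suff : INR k * (ln (INR k.+1) - ln (INR k)) <= 1 by move: IH; rewrite S_INR; nra.
case: k k1 {IH f0} => [|k] k1; first by rewrite /= Rmult_0_l; lra.
have k0 : 0 < INR k.+1 by apply: lt_0_INR; apply/ltP.
rewrite -ln_quot //; have := @ln_le_sub1 (INR k.+2 / INR k.+1) (Rdiv_lt_0_compat _ _ k1 k0).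
move=> /(Rmult_le_compat_l _ _ _ (Rlt_le _ _ k0)) h; apply: Rle_trans h _.
by rewrite (S_INR k.+1); right; field; lra.
Qed.

(** The two values of [lam] are the logarithms of [z = 1] and [z = n / d^2], each satisfying one of
    the alternatives in [Gdc_card_le]; the term [2 * M] is [d n]. *)
Lemma ln_Gdc_card_le n d (c lam : R) : (0 < n)%N -> (0 < d)%N -> ~~ odd (d * n) ->
  (0 < Gdc_card n d c)%N ->
  0 <= lam -> lam = 0 \/ lam = ln (INR n / INR d ^ 2) ->
  let M := INR d * INR n / 2 in
  ln (INR (Gdc_card n d c)) <=
    2 * M + M * ln (INR n / INR d) - lam * (c * ((INR d - 1) / (INR d + 1)) * M).
Proof.
move=> n0 d0 dn g0 l0 hl M; set mu := c * _ * M.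
have Rn0 : 0 < INR n by apply/lt_0_INR/ltP.
have Rd0 : 0 < INR d by apply/lt_0_INR/ltP.
have Rg0 : 0 < INR (Gdc_card n d c) by apply/lt_0_INR/ltP.
pose m := (d * n)./2.
have hm : (m * 2 = n * d)%N.
  by have := odd_double_half (d * n); rewrite (negbTE dn) add0n -muln2 => ->; rewrite mulnC.
have mM : INR m = M by have := congr1 INR hm; rewrite !mult_INR /M /=; lra.
have hl' : exp lam <= 1 \/ exp lam * INR d ^ 2 <= INR n.
  case: hl => ->; first by left; rewrite exp_0; lra.
  right; rewrite exp_ln; first by right; field; lra.
  by apply: Rdiv_lt_0_compat => //; nra.
have hmu : mu * INR d.+1 <= c * Tmax n d * INR 3.
  have := INR_bin2 d => b2; right; rewrite [INR d.+1]S_INR (_ : INR 3 = 3) ?[INR 3]/=; last by rewrite /=; lra.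
  rewrite /mu /Tmax /M.
  have -> : INR 'C(d, 2) = INR d * (INR d - 1) / 2 by lra.
  by field; lra.
have := @Gdc_card_le n d m c lam mu n0 hm.
rewrite -!INRE -!RpowE => h.
have {h} /RleP := h (introT RleP l0) ltac:(case: hl' => /RleP; by [left | right])
  (introT RleP hmu).
have e0 x : 0 < exp x by apply: exp_pos.
set G := INR (Gdc_card n d c) in Rg0 *; change (GRing.mul (INR d) (GRing.inv (INR n))) with (INR d / INR n).
move=> h; have p0 : 0 < INR d / INR n by apply: Rdiv_lt_0_compat.
have pm0 := pow_lt _ m p0.
have : ln (G * (exp (lam * mu) * (INR d / INR n) ^ m)) <= INR d * INR n.
  rewrite -[X in _ <= X]ln_exp; apply: ln_mono h; apply: Rmult_lt_0_compat => //.
  exact: Rmult_lt_0_compat.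
rewrite ln_mult //; last exact: Rmult_lt_0_compat.
rewrite ln_mult // ln_exp ln_pow // !ln_quot // mM.
by rewrite (_ : INR d * INR n = 2 * M); [lra | rewrite /M; field].
Qed.

(** * The lower bound after taking logarithms *)

Lemma nat_above x : 0 <= x -> exists k : nat, x <= INR k <= x + 1.
Proof.
move=> x0; have [h1 h2] := archimed x; exists (Z.to_nat (up x)).
rewrite INR_IZR_INZ Znat.Z2Nat.id; first by lra.
by apply: le_IZR; lra.
Qed.

(** The required and the available number of triangles are [c n] and [(d + 1) k] times
    ['C(d, 2) / 3], whence the condition on [k]. *)
Lemma ln_Gdc_card_ge n d k t N (c : R) :
  n = (d.+1 * k + d.+1 * t + N)%N -> (d < N)%N -> ~~ odd (d * N) ->
  0 < c -> c * INR n <= (INR d + 1) * INR k ->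
  (0 < Gdc_card n d c)%N /\
  INR d * (INR k * ln (INR k) - INR k)
    + INR d * (INR d + 1) / 2 * (INR t * ln (INR t) - INR t) <= ln (INR (Gdc_card n d c)).
Proof.
move=> nE dN dNe c0 ck; have := @Gdc_card_ge n d k t N c nE dN dNe.
have b2 := INR_bin2 d; have b3 := INR_bin3 d; have Rd := pos_INR d.
have b20 := pos_INR 'C(d, 2).
have hT : c * Tmax n d <= INR ('C(d.+1, 3) * k).
  rewrite mult_INR /Tmax.
  have := Rmult_le_compat_l _ _ _ b20 ck; nra.
move=> /(_ hT) hG; have f0 m : (0 < m`!)%N := fact_gt0 m.
have P0 : (0 < k`! ^ d * t`! ^ 'C(d.+1, 2))%N by rewrite muln_gt0 !expn_gt0 !f0.
have Rf0 m : 0 < INR m`! by apply/lt_0_INR/ltP.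
split; first exact: leq_trans P0 hG.
apply: (Rle_trans _ (ln (INR (k`! ^ d * t`! ^ 'C(d.+1, 2))))); last first.
  by apply: ln_mono; [apply/lt_0_INR/ltP | apply/le_INR/leP].
rewrite mult_INR !INR_expn ln_mult ?ln_pow //; try exact: pow_lt.
have -> : INR 'C(d.+1, 2) = INR d * (INR d + 1) / 2 by have := INR_bin2 d.+1; rewrite S_INR; lra.
apply: Rplus_le_compat; apply: Rmult_le_compat_l; rewrite ?S_INR; try exact: ln_fact_ge; nra.
Qed.

(** Passing between the denominators [d] and [d + 1] costs [ln ((d + 1) / d) <= 1 / d <= 1]. *)
Lemma ln_ratio_bounds x d : 1 <= x -> 1 <= d ->
  ln (x / (d + 1)) <= ln (x / d) <= ln (x / (d + 1)) + 1.
Proof.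
move=> x1 d1; have := @ln_mono d (d + 1) ltac:(lra) ltac:(lra).
have := @ln_le_sub1 ((d + 1) / d) ltac:(apply: Rdiv_lt_0_compat; lra).
rewrite !ln_quot; try lra.
have := Rinv_le_contravar 1 d ltac:(lra) d1.
have -> : (d + 1) / d - 1 = / d by field; lra.
by rewrite Rinv_1; lra.
Qed.

(** With [a = c (1 - c) / 2], both [k] and [t] will be at least [a X], so their logarithms are at
    least [ln X + ln a]; [A] combines [- ln a] with the 1 lost in [ln_fact_ge]. The term
    [6 / (1 - c)] ensures [(1 - c) X - 3 >= a X]. *)
Lemma Gdc_card_lower (c : R) n d :
  let X := INR n / (INR d + 1) in let M := INR d * INR n / 2 in
  let A := 1 - ln (c * ((1 - c) / 2)) in
  0 < c < 1 -> (0 < d)%N -> ~~ odd (d * n) -> exp A + 6 / (1 - c) <= X ->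
  (0 < Gdc_card n d c)%N /\
  M * ln X * (1 - c * ((INR d - 1) / (INR d + 1))) - (A + 3) * M
    <= ln (INR (Gdc_card n d c)).
Proof.
move=> X M A c01 d0 dn hX; set a := c * ((1 - c) / 2) in A hX *.
have D1 : 1 <= INR d by rewrite -[1]/(INR 1); apply/le_INR/leP.
have a0 : 0 < a by rewrite /a; nra.
have e0 := exp_pos A.
have q0 : 0 < 6 / (1 - c) by apply: Rdiv_lt_0_compat; lra.
have X6 : 6 <= (1 - c) * X.
  have -> : 6 = (1 - c) * (6 / (1 - c)) by field; lra.
  by apply: Rmult_le_compat_l; lra.
have X0 : 0 < X by lra.
have nX : INR n = X * (INR d + 1) by rewrite /X; field; lra.
have Y_A : A <= ln X by rewrite -[A]ln_exp; apply: ln_mono; lra.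
have Y_X : ln X <= X by have := ln_le_sub1 X0; lra.
have A1 : 1 <= A.
  have : ln a <= a - 1 by apply: ln_le_sub1.
  have : a <= 1 by rewrite /a; nra.
  by rewrite /A; lra.
have [k [kX Xk]] := @nat_above (c * X) ltac:(nra).
pose q := (n %/ d.+1)%N; pose r := (n %% d.+1)%N.
have qr : n = (q * d.+1 + r)%N := divn_eq n d.+1.
have rd : (r < d.+1)%N by apply: ltn_pmod.
have qX : X - 1 <= INR q.
  have : INR n <= INR q * (INR d + 1) + (INR d + 1).
    have := congr1 INR qr; rewrite plus_INR mult_INR S_INR => ->.
    apply: Rplus_le_compat_l; rewrite -S_INR; apply/le_INR/leP; exact: ltnW.
  by rewrite nX; nra.
have kq : (k < q)%N by apply/ltP/INR_lt; lra.
(* One more block of [d + 1] vertices is held back and joined to the [r] left over, so that the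
   remainder has more than [d] vertices and carries a [d]-regular graph. *)
pose t := (q - k.+1)%N.
have tX : (1 - c) * X - 3 <= INR t.
  have : (t + k.+1 = q)%N by rewrite subnK.
  by move/(congr1 INR); rewrite plus_INR S_INR; lra.
have nE : n = (d.+1 * k + d.+1 * t + (d.+1 + r))%N by rewrite {1}qr /t; nia.
(* Removing blocks of [d + 1] vertices keeps the parity of the degree sum, as [d (d + 1)] is
   even. *)
have dN : ~~ odd (d * (d.+1 + r)).
  by move: dn; rewrite {1}qr !oddM !oddD oddM /=; case: (odd d); rewrite ?andbF.
have ck : c * INR n <= (INR d + 1) * INR k by rewrite nX; nra.
have [|G0 hG] := @ln_Gdc_card_ge n d k t (d.+1 + r) c nE _ dN (proj1 c01) ck.
  by rewrite addSn ltnS leq_addr.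
split=> //; apply: Rle_trans hG.
have ac : a <= c by rewrite /a; nra.
have ac' : a <= (1 - c) / 2 by rewrite /a; nra.
have fact_term y m : 0 <= y -> y <= INR m -> a * X <= INR m ->
    y * (ln X - A) <= INR m * ln (INR m) - INR m.
  move=> y0 ym am; have aX0 : 0 < a * X by apply: Rmult_lt_0_compat.
  have := ln_mono aX0 am; rewrite ln_mult // => h.
  apply: (Rle_trans _ (INR m * (ln X - A))); first by apply: Rmult_le_compat_r; lra.
  apply: Rle_trans (Rmult_le_compat_l _ _ (ln (INR m) - 1) (pos_INR m) _) _; last by right; ring.
  by rewrite /A; lra.
have aX c' : a <= c' -> a * X <= c' * X by move=> h; apply: Rmult_le_compat_r; lra.
have hk : c * X * (ln X - A) <= INR k * ln (INR k) - INR k.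
  by apply: fact_term; have := aX _ ac; nra.
have ht : ((1 - c) * X - 3) * (ln X - A) <= INR t * ln (INR t) - INR t.
  by apply: fact_term; have := aX _ ac'; lra.
apply: Rle_trans (Rplus_le_compat _ _ _ _ (Rmult_le_compat_l (INR d) _ _ _ hk)
  (Rmult_le_compat_l (INR d * (INR d + 1) / 2) _ _ _ ht)); try nra.
set Y := ln X in Y_A Y_X *.
have MX : M = INR d * (INR d + 1) / 2 * X by rewrite /M nX; lra.
set K := INR d * (INR d + 1) / 2 in MX *.
set u := 1 - c * ((INR d - 1) / (INR d + 1)).
have K0 : 0 < K by rewrite /K; nra.
(* The leading terms add up exactly, because [M = K X] and [(d - 1) / (d + 1) = 1 - 2 / (d + 1)]. *)
have uE : INR d * (c * X) + K * ((1 - c) * X) = M * u.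
  by rewrite MX /K /u; field; lra.
have u1 : u <= 1.
  rewrite /u; have : 0 <= (INR d - 1) / (INR d + 1) by apply: Rmult_le_pos; [lra | apply/Rlt_le/Rinv_0_lt_compat; lra].
  by nra.
have -> : INR d * (c * X * (Y - A)) + K * (((1 - c) * X - 3) * (Y - A))
   = M * u * (Y - A) - 3 * K * (Y - A) by rewrite -uE; ring.
have M0 : 0 < M by rewrite MX; nra.
(* The losses are [A] times [M u <= M], and the 3 subtracted in the bound on [t], which costs
   [3 K (Y - A) <= 3 K X = 3 M]. *)
have h1 := Rmult_le_compat_l (M * A) u 1 ltac:(apply: Rmult_le_pos; lra) u1.
have h2 := Rmult_le_compat_l K (Y - A) X (Rlt_le _ _ K0) ltac:(lra).
by rewrite MX in h1 *; lra.
Qed.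

(** * The upper bound after taking logarithms *)

Lemma Gdc_card_upper (c : R) n d :
  let Y := ln (INR n / (INR d + 1)) in let M := INR d * INR n / 2 in
  0 < c < 1 -> (0 < d)%N -> (d <= n)%N -> ~~ odd (d * n) -> (0 < Gdc_card n d c)%N ->
  ln (INR (Gdc_card n d c)) <=
    M * Y * (1 - c * ((INR d - 1) / (INR d + 1))) + c * M * ln (INR d) + 3 * M.
Proof.
move=> Y M c01 d0 d_n dn G0; have n0 := leq_trans d0 d_n.
have D1 : 1 <= INR d by rewrite -[1]/(INR 1); apply/le_INR/leP.
have N1 : 1 <= INR n by rewrite -[1]/(INR 1); apply/le_INR/leP.
have M0 : 0 < M by rewrite /M; nra.
set v := (INR d - 1) / (INR d + 1).
have v01 : 0 <= v <= 1.
  have i0 : 0 < / (INR d + 1) by apply: Rinv_0_lt_compat; lra.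
  split; first by apply: Rmult_le_pos; lra.
  have -> : v = 1 - 2 * / (INR d + 1) by rewrite /v; field; lra.
  by lra.
have [YL LY] := ln_ratio_bounds N1 D1; rewrite -/Y in YL LY.
set L := ln (INR n / INR d) in YL LY.
have LE : L = ln (INR n) - ln (INR d) by apply: ln_quot; lra.
have lnd0 : 0 <= ln (INR d) by rewrite -ln_1; apply: ln_mono; lra.
have lE : ln (INR n / INR d ^ 2) = L - ln (INR d).
  rewrite ln_quot ?ln_pow ?LE //=; try lra; nra.
have cv : 0 <= c * v <= c by nra.
(* If [d^2 <= n], take [z = n / d^2]: then [lam = L - ln d] falls short of [L] by [ln d], at a cost
   of at most [c M ln d]. Otherwise take [z = 1]: the forgone saving [c v Y M] is at most
   [c M ln d], since [Y <= L < ln d]. *)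
case: (Rle_lt_dec (ln (INR d)) L) => hd.
  have := @ln_Gdc_card_le n d c _ n0 d0 dn G0 _ (or_intror (erefl _)).
  rewrite lE => /(_ ltac:(lra)); rewrite -/M -/L -/v => h; apply: Rle_trans h _.
  have : c * v * ln (INR d) <= c * ln (INR d) by nra.
  have : (1 - c * v) * L <= (1 - c * v) * Y + 1 by nra.
  move=> h1 h2.
  have := Rmult_le_compat_l M _ _ (Rlt_le _ _ M0) h1.
  have := Rmult_le_compat_l M _ _ (Rlt_le _ _ M0) h2.
  by nra.
have := @ln_Gdc_card_le n d c 0 n0 d0 dn G0 (Rle_refl _) (or_introl (erefl _)).
rewrite -/M -/L -/v => h; apply: Rle_trans h _.
have h1 : c * v * Y <= c * ln (INR d) by nra.
have := Rmult_le_compat_l M _ _ (Rlt_le _ _ M0) h1.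
by nra.
Qed.

(** * Combining the two bounds *)

Lemma le_div_pos x y z : 0 < z -> x * z <= y -> x <= y / z.
Proof.
move=> z0 h; apply: (Rmult_le_reg_r z) => //.
by rewrite /Rdiv Rmult_assoc Rinv_l; lra.
Qed.

Lemma even_odd m : Nat.even m = ~~ odd m.
Proof.
suff: Nat.even m = ~~ odd m /\ Nat.even m.+1 = odd m by case.
by elim: m => // m [E O]; split; [rewrite O /= negbK | exact: E].
Qed.

Theorem theorem1 (c : R) (d : nat -> nat) :
  (0 < c < 1)%R ->
  (forall n : nat, (1 <= d n)%coq_nat) ->
  Un_cv (fun n : nat => (INR (d n) / INR n)%R) 0%R ->
  exists (C : R) (N : nat), forall n : nat, (N <= n)%coq_nat ->
    Nat.even (d n * n) = true ->
    let L := ln (INR n / INR (d n))%R in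
    let Q := (ln (INR (Gdc_card n (d n) c))
              / ((INR (d n) * INR n / 2) * ln (INR n / (INR (d n) + 1)))
              - (1 - c * ((INR (d n) - 1) / (INR (d n) + 1))))%R in
    (- (C / L) <= Q <=
       c * (ln (INR (d n)) / ln (INR n / (INR (d n) + 1))) + C / L)%R.
Proof.
move=> c01 dpos dcv; pose A := 1 - ln (c * ((1 - c) / 2)).
have A1 : 1 <= A.
  have a0 : 0 < c * ((1 - c) / 2) by nra.
  have := ln_le_sub1 a0; have : c * ((1 - c) / 2) <= 1 by nra.
  by rewrite /A; lra.
pose X0 := exp A + 6 / (1 - c).
have X0_2 : 2 <= X0.
  have : 0 < 6 / (1 - c) by apply: Rdiv_lt_0_compat; lra.
  by have := exp_ineq1_le A; rewrite /X0; lra.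
(* Eventually [n >= 2 X0 d >= X0 (d + 1)], the threshold of [Gdc_card_lower]. *)
have [N0 hN0] := dcv (/ (2 * X0)) ltac:(apply: Rinv_0_lt_compat; lra).
(* Both errors are at most [(A + 3) M]. The factor 2 replaces [Y] by [L] in the denominator, as
   [L <= Y + 1 <= 2 Y]. Starting at [N0.+1] keeps [n] positive. *)
exists (2 * (A + 3)), N0.+1 => n /leP Nn; rewrite even_odd => dn.
have d0 : (0 < d n)%N by apply/leP.
have D1 : 1 <= INR (d n) by rewrite -[1]/(INR 1); apply/le_INR/leP.
have N1 : 1 <= INR n by rewrite -[1]/(INR 1); apply/le_INR/leP; apply: leq_trans Nn.
have nd : 2 * X0 * INR (d n) <= INR n.
  have := hN0 n ltac:(apply/leP; exact: ltnW); rewrite /Rdist Rminus_0_r.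
  rewrite Rabs_pos_eq; last by apply: Rmult_le_pos; [lra | apply/Rlt_le/Rinv_0_lt_compat; lra].
  move=> h; have /(Rmult_le_compat_l (2 * X0 * INR n)) := Rlt_le _ _ h.
  have -> : 2 * X0 * INR n * / (2 * X0) = INR n by field; lra.
  have -> : 2 * X0 * INR n * (INR (d n) / INR n) = 2 * X0 * INR (d n) by field; lra.
  by apply; nra.
have X0X : X0 <= INR n / (INR (d n) + 1).
  by apply: le_div_pos; nra.
have d_n : (d n <= n)%N by apply/leP/INR_le; nra.
have [G0 low] := Gdc_card_lower c01 d0 dn X0X.
have up := Gdc_card_upper c01 d0 d_n dn G0.
have [YL LY] := ln_ratio_bounds N1 D1.
have Y1 : 1 <= ln (INR n / (INR (d n) + 1)).
  apply: Rle_trans A1 _; rewrite -[A]ln_exp; apply: ln_mono; first exact: exp_pos.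
  apply: Rle_trans X0X; have : 0 < 6 / (1 - c) by apply: Rdiv_lt_0_compat; lra.
  by rewrite /X0; lra.
have M0 : 0 < INR (d n) * INR n / 2 by nra.
move: YL LY low up Y1 M0; rewrite -/A.
set Y := ln (INR n / _); set M := _ / 2; set u := 1 - _; set g := ln (INR (Gdc_card _ _ _)).
move=> YL LY low up Y1 M0 L Q; rewrite -/L in YL LY.
have CL : (A + 3) / Y <= 2 * (A + 3) / L.
  apply: le_div_pos; first by lra.
  have -> : (A + 3) / Y * L = (A + 3) * (L / Y) by field; lra.
  suff : L / Y <= 2 by nra.
  by apply: (Rmult_le_reg_r Y); [lra | rewrite /Rdiv Rmult_assoc Rinv_l; lra].
have QE : Q * (M * Y) = g - u * (M * Y) by rewrite /Q; field; lra.
have MY : 0 < M * Y by nra.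
split.
  apply: (Rmult_le_reg_r (M * Y)) => //; rewrite QE.
  have := Rmult_le_compat_r (M * Y) _ _ (Rlt_le _ _ MY) CL.
  have -> : (A + 3) / Y * (M * Y) = (A + 3) * M by field; lra.
  by lra.
apply: (Rmult_le_reg_r (M * Y)) => //; rewrite QE.
have := Rmult_le_compat_r (M * Y) _ _ (Rlt_le _ _ MY) CL.
have -> : (A + 3) / Y * (M * Y) = (A + 3) * M by field; lra.
have : c * (ln (INR (d n)) / Y) * (M * Y) = c * M * ln (INR (d n)) by field; lra.
by nra.
Qed.
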